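(* For every $\gamma>0$ there exist a filtered probability space, a random process $Y=(Y_t:t\ge 0)$ on it with $Y_0=0$, and constants $\mu>0$ and $\sigma^2\ge 0$ with $\gamma=\frac{\mu}{\sigma^2}$ (so in particular $\sigma^2\neq 0$), such that $(Y_t+\mu t:t\ge 0)$ and $([Y,Y]_t-\sigma^2 t:t\ge 0)$ are supermartingales and, with $Y^*=\sup\{Y_t:t\ge 0\}$, $$P\{Y^*\ge a\}\ge \frac{1}{5(1+a\gamma)}\qquad\text{for all } a\ge 0.$$ In particular, $E[Y^*]=+\infty$ for this choice of $Y$.
   Context: The probability space $(\Omega,\mathcal{F},P)$ is complete, with a filtration $(\mathcal{F}_t:t\ge 0)$ satisfying the usual conditions (right-continuity and inclusion of all sets of probability zero); supermartingale properties are with respect to this filtration. A semimartingale is a process that is càdlàg (right continuous with finite left limits) and can be written as the sum of a càdlàg local martingale and a càdlàg adapted process of locally finite variation. The quadratic variation process $[Y,Y]$ of a semimartingale $Y$ is the nondecreasing process $[Y,Y]_t=\lim_{n\to\infty}\sum_{i=0}^{k_n-1}(Y_{t^n_{i+1}}-Y_{t^n_i})^2$ (limit in probability) for any partitions $0=t^n_0<t^n_1<\cdots<t^n_{k_n}=t$ with $\max_i|t^n_{i+1}-t^n_i|\to 0$. A process $Z$ is a supermartingale if $E[Z_t-Z_s\mid\mathcal{F}_s]\le 0$ for $0\le s\le t$ (with the usual adaptedness and integrability). *)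

(* Defs.v *)
From HB Require Import structures.
From mathcomp Require Import all_boot all_order all_algebra.
From mathcomp Require Import all_classical all_reals all_analysis.

Set Implicit Arguments.
Unset Strict Implicit.
Unset Printing Implicit Defensive.
Import Order.TTheory GRing.Theory Num.Theory.
Import numFieldNormedType.Exports.
Local Open Scope classical_set_scope.
Local Open Scope ring_scope.

(* Real-valued processes and filtrations are functions of a time in R, of which
   only the restriction to t >= 0 is ever used. *)

Section processes.
Context d (T : measurableType d) (R : realType) (P : probability T R).
Implicit Types (G : set_system T) (F : R -> set_system T).
Implicit Types (X C : T -> R) (Y Z M A Q : R -> T -> R).

Definition usual_filtration F : Prop :=
  [/\ forall t, 0 <= t -> sigma_algebra setT (F t) /\ F t `<=` measurable,
      forall s t, 0 <= s -> s <= t -> F s `<=` F t,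
      forall t, 0 <= t -> F t = \bigcap_(s in [set s | t < s]) F s &
      forall N, P.-negligible N -> F 0 N].

Definition measurable_wrt G X : Prop :=
  forall B : set (measurableTypeR R), measurable B -> G (X @^-1` B).

Definition adapted F Y : Prop :=
  forall t, 0 <= t -> measurable_wrt (F t) (Y t).

(* C is a version of the conditional expectation E[X | G], for X integrable. *)
Definition is_condexp G X C : Prop :=
  [/\ measurable_wrt G C,
      P.-integrable setT (EFin \o C) &
      forall B, G B -> (\int[P]_(w in B) (C w)%:E = \int[P]_(w in B) (X w)%:E)%E].

Definition integrable_process Y : Prop :=
  forall t, 0 <= t -> P.-integrable setT (EFin \o Y t).

Definition martingale F M : Prop :=
  [/\ adapted F M, integrable_process M &
      forall s t, 0 <= s -> s <= t -> is_condexp (F s) (M t) (M s)].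

Definition supermartingale F Z : Prop :=
  [/\ adapted F Z, integrable_process Z &
      forall s t, 0 <= s -> s <= t ->
        exists2 C, is_condexp (F s) (fun w => Z t w - Z s w) C &
                   {ae P, forall w, C w <= 0}].

Definition cadlag (f : R -> R) : Prop :=
  (forall t, 0 <= t -> f x @[x --> t^'+] --> f t) /\
  (forall t, 0 < t -> exists l : R, f x @[x --> t^'-] --> l).

Definition cadlag_process Y : Prop := forall w, cadlag (Y ^~ w).

Definition stopping_time F (tau : T -> \bar R) : Prop :=
  (forall w, (0 <= tau w)%E) /\
  (forall t, 0 <= t -> F t [set w | (tau w <= t%:E)%E]).

(* For t >= 0 and tau >= 0 the minimum is a real number, so fine is harmless. *)
Definition stopped M (tau : T -> \bar R) : R -> T -> R :=
  fun t w => M (fine (mine t%:E (tau w))) w.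

Definition local_martingale F M : Prop :=
  adapted F M /\
  exists tau : nat -> T -> \bar R,
    [/\ forall n, stopping_time F (tau n),
        forall n w, (tau n w <= tau n.+1 w)%E,
        {ae P, forall w, tau n w @[n --> \oo] --> +oo%E} &
        forall n, martingale F (fun t w => stopped M (tau n) t w - M 0 w)].

Definition locally_finite_variation A : Prop :=
  forall w t, 0 <= t -> bounded_variation 0 t (A ^~ w).

Definition semimartingale F Y : Prop :=
  cadlag_process Y /\
  exists M A,
    [/\ cadlag_process M /\ local_martingale F M,
        [/\ cadlag_process A, adapted F A & locally_finite_variation A] &
        forall t w, 0 <= t -> Y t w = M t w + A t w].

(* As in itv_partition, the points 0 = t_0 < t_1 < ... < t_k = t are coded by
   the list s = [:: t_1; ...; t_k], and t_i = nth 0 (0 :: s) i. *)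
Definition mesh (s : seq R) : R :=
  \big[Num.max/0]_(i < size s) `|nth 0 (0 :: s) i.+1 - nth 0 (0 :: s) i|.

Definition sum_sq_increments Y (s : seq R) (w : T) : R :=
  \sum_(i < size s) (Y (nth 0 (0 :: s) i.+1) w - Y (nth 0 (0 :: s) i) w) ^+ 2.

Definition cvg_in_probability (X_ : nat -> T -> R) X : Prop :=
  forall eps : R, 0 < eps ->
    P [set w | eps < `|X_ n w - X w|] @[n --> \oo] --> 0%E.

(* Q is a version of the quadratic variation process [Y, Y]: for each t, this
   determines Q t up to an event of probability zero. *)
Definition is_quadratic_variation Y Q : Prop :=
  [/\ forall t, 0 <= t -> measurable_fun setT (Q t),
      forall w s t, 0 <= s -> s <= t -> Q s w <= Q t w &
      forall t (pi : nat -> seq R), 0 <= t ->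
        (forall n, itv_partition 0 t (pi n)) ->
        mesh (pi n) @[n --> \oo] --> 0 ->
        cvg_in_probability (fun n => sum_sq_increments Y (pi n)) (Q t)].

Definition Ysup Y (w : T) : \bar R :=
  ereal_sup [set (Y t w)%:E | t in [set t : R | 0 <= t]].

End processes.

(* Main.v *)
Require Import Defs.
From HB Require Import structures.
From mathcomp Require Import all_boot all_order all_algebra.
From mathcomp Require Import all_classical all_reals all_analysis.
From mathcomp Require Import measurable_realfun.
From mathcomp Require Import ring lra.
Set Implicit Arguments.
Unset Strict Implicit.
Unset Printing Implicit Defensive.
Import Order.TTheory GRing.Theory Num.Theory.
Import numFieldNormedType.Exports.
Local Open Scope classical_set_scope.
Local Open Scope ring_scope.

(** Start with gamma = 1 and mu = sigma2 = 1.  Let a clock tau ring at most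
    once, with P(tau > t) = 4/5 + 1 / (5 (1 + sqrt t)^2), so that it never rings
    with probability 4/5, and take
      Y_t = (2 tau + 3 sqrt tau) 1_{tau <= t} - t - sqrt t.
    Before the clock rings Y is nonpositive, when it rings Y jumps up to
    (1 + sqrt tau)^2 - 1, and afterwards it decreases.  Hence
    P(Y* >= a) = P((1 + sqrt tau)^2 >= 1 + a, tau < oo) = 1 / (5 (1 + a))
    for a > 0, and this tail is not integrable.

    The term -t gives Y the drift -1 that is asked for, the term -sqrt t pays for
    the jump, and the square of the jump is paid for by the -t of [Y, Y]_t - t.
    Since the survival probability never drops below 4/5, it suffices that
      E[J; s < tau <= t] <= 4/5 (sqrt t - sqrt s)  and
      E[J^2; s < tau <= t] <= 4/5 (t - s),
    where J is the size of the jump.  With w = 1 + sqrt tau we have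
    J = (w - 1) (2 w + 1), the density of w is 2 / (5 w^3), and the two
    inequalities hold already between the densities:
    J <= 2 w^3 and J^2 <= 4 (w - 1) w^3 for w >= 1 ([integral_jump_size_le] and
    [integral_jump_size_sqr_le]).  For general gamma everything is multiplied
    by 1 / gamma, so that mu = 1 / gamma and sigma2 = 1 / gamma^2.

    The probability space is a complete one that carries a uniform variable U
    ([exists_complete_uniform]), with 5 U = 1 / w^2 when the clock rings.  The
    filtration reveals only whether the clock has rung and, if so, everything:
    an event of time t is one that is trivial, up to null sets, on {tau > t}.
    This makes right-continuity elementary and conditional expectations
    explicit: they average over {tau > s} and change nothing elsewhere
    ([is_condexp_jump_filtration]).  The paths of Y have finite variation, so Y
    is a semimartingale with zero martingale part, and its quadratic variation
    is the squared jump ([quadratic_variation_jumped]). *)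

(** * A complete probability space with a uniform variable *)

Section completion.
Context d (T : measurableType d) (R : realType) (P : probability T R).

Let outer : {outer_measure set T -> \bar R} := (P^*)%mu.

(** The completion of P: the outer measure of P, on its Caratheodory measurable
    sets. *)
Definition completion : set (caratheodory_type outer) -> \bar R := outer.

HB.instance Definition _ := Measure.on completion.

Let completion_setT : completion setT = 1%E.
Proof. rewrite -(@probability_setT _ _ _ P); exact: measurable_mu_extE. Qed.

HB.instance Definition _ :=
  @Measure_isProbability.Build _ _ R completion completion_setT.

(** Completeness costs nothing as long as one only speaks of the law of a random
    variable: the identity, read as a map from the completion of P to the
    original space, has law P. *)
Lemma exists_complete_random_variable :
  exists (d' : measure_display) (T' : measurableType d')
         (P' : probability T' R) (U : T' -> T),
    [/\ measure_is_complete P', measurable_fun setT U &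
        forall A, measurable A -> P' (U @^-1` A) = P A].
Proof.
exists _, (caratheodory_type outer), completion, idfun; split.
- exact: measure_is_complete_caratheodory.
- move=> _ A mA; rewrite setTI.
  by apply: sub_caratheodory; exact: sub_sigma_algebra.
- by move=> A mA; exact: measurable_mu_extE.
Qed.

End completion.

(** The law of U is stated through integrals of nonnegative functions, which is
    the form in which expectations of functions of U are computed below. *)
Lemma exists_complete_uniform (R : realType) :
  exists (d : measure_display) (T : measurableType d) (P : probability T R)
         (U : T -> R),
    [/\ measure_is_complete P, measurable_fun setT U &
        forall (A : set R) (f : R -> \bar R),
          measurable A ->
          measurable_fun A f -> (forall x, A x -> (0 <= f x)%E) ->
          (\int[P]_(w in U @^-1` A) f (U w) =
           \int[lebesgue_measure]_(x in A `&` `[0%R, 1%R]) f x)%E].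
Proof.
have [d [T [P [U [cP mU PU]]]]] :=
  exists_complete_random_variable (uniform_prob (@ltr01 R)).
exists d, T, P, U; split=> // A f mA mf f0.
rewrite -(ge0_integral_pushforward mU)//; last by move=> x /[!inE]; exact: f0.
transitivity (\int[uniform_prob (@ltr01 R)]_(x in A) f x)%E.
  by apply: eq_measure_integral => B mB _; exact: PU.
rewrite integral_mkcond integral_uniform; last 2 first.
- exact/(measurable_restrictT _ mA).
- by move=> x; apply: erestrict_ge0.
by rewrite subr0 invr1 mul1e setIC [RHS]integral_mkcondr.
Qed.

(** * The filtration of a single jump *)

Section jump_filtration.
Context d (T : measurableType d) (R : realType) (P : probability T R).
Variable tau : T -> \bar R.

Definition before t : set T := [set w | (t%:E < tau w)%E].

(** The events known at time t when the only thing ever observed is whether tau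
    has passed, and everything is revealed once it has: on {t < tau} nothing is
    known, so that such an event is null or full there.  Asking this only up to
    null sets puts all null sets in at time zero. *)
Definition jump_filtration (t : R) : set_system T :=
  [set A | measurable A /\
    (P.-negligible (A `&` before t) \/ P.-negligible (~` A `&` before t))].

Lemma before_le s t : s <= t -> before t `<=` before s.
Proof. by move=> st w; apply: le_lt_trans; rewrite lee_fin. Qed.

Lemma jump_filtration_sigma_algebra t : sigma_algebra setT (jump_filtration t).
Proof.
split.
- split; first exact: measurable0.
  by left; rewrite set0I; exact: negligible_set0.
- move=> A [mA HA]; rewrite setTD; split; first exact: measurableC.
  by rewrite setCK; case: HA; [right|left].
- move=> A HA; split; first by apply: bigcupT_measurable => n; case: (HA n).
  have [[n Hn]|/forallNP Hn] :=
    pselect (exists n, P.-negligible (~` A n `&` before t)).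
    right; apply: negligibleS Hn; apply: setSI; apply: subsetC.
    exact: bigcup_sup.
  left; rewrite setI_bigcupl; apply: negligible_bigcup => n.
  by have [_ []] := HA n => // /(Hn n).
Qed.

Lemma jump_filtration_nondecreasing s t :
  s <= t -> jump_filtration s `<=` jump_filtration t.
Proof.
move=> st A [mA HA]; split=> //.
by case: HA => HA; [left|right]; apply: negligibleS HA; apply: setIS;
  exact: before_le.
Qed.

(** Since {t < tau} is the increasing union of the sets {t + 1/n < tau}, an
    event that is null on all of them is null on {t < tau}; and if it fails to
    be null on one of them, then it is full on that one and on all larger
    ones. *)
Lemma jump_filtration_right_continuous t :
  jump_filtration t = \bigcap_(s in [set s | t < s]) jump_filtration s.
Proof.
apply/seteqP; split=> [A FA s /= /ltW/jump_filtration_nondecreasing|A HA].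
  exact.
have tn n : t < t + n.+1%:R^-1 by rewrite ltrDl invr_gt0.
have beforeE : before t = \bigcup_n before (t + n.+1%:R^-1).
  apply/seteqP; split=> [w|w [n _]]; last exact/before_le/ltW.
  rewrite /before/=; case tauw: (tau w) => [r| |] //.
    move=> tr; have rt : t < r by rewrite -lte_fin.
    have [n nr] := ltr_add_invr tr.
    by exists n => //; rewrite /= tauw lte_fin.
  by move=> _; exists 0%N => //; rewrite /= tauw ltry.
have FA n : jump_filtration (t + n.+1%:R^-1) A by exact: (HA _ (tn n)).
split; first by case: (FA 0%N).
have [Hl|/existsNP[n Hn]] :=
    pselect (forall n, P.-negligible (A `&` before (t + n.+1%:R^-1))).
  by left; rewrite beforeE setI_bigcupr; exact: negligible_bigcup.
right; rewrite beforeE setI_bigcupr; apply: negligible_bigcup => m.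
have [nm|mn] := leqP n m.
  have [_ []//] := FA m.
  move=> Am; exfalso; apply: Hn; apply: negligibleS Am.
  by apply: setIS; apply: before_le;
    rewrite lerD2l lef_pV2 ?posrE// ler_nat ltnS.
have [_ []//] := FA n.
apply: negligibleS.
by apply: setIS; apply: before_le;
  rewrite lerD2l lef_pV2 ?posrE// ler_nat ltnS ltnW.
Qed.

Lemma usual_jump_filtration :
  measure_is_complete P -> usual_filtration P jump_filtration.
Proof.
move=> cP; split.
- by move=> t _; split; [exact: jump_filtration_sigma_algebra|move=> A []].
- by move=> s t _; exact: jump_filtration_nondecreasing.
- by move=> t _; exact: jump_filtration_right_continuous.
- move=> N N0; split; first exact: cP.
  by left; apply: negligibleS N0; exact: subIsetl.
Qed.

End jump_filtration.

Section conditional_expectation.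
Context d (T : measurableType d) (R : realType) (P : probability T R).
Variable tau : T -> \bar R.
Hypothesis mtau : measurable_fun setT tau.

Let F := jump_filtration P tau.

Lemma measurable_before t : measurable (before tau t).
Proof.
rewrite -[before _ _]setTI.
exact: (measurable_lte measurableT (measurable_cst t%:E) mtau).
Qed.

Lemma measurable_fun_tau_le t :
  measurable_fun setT (fun w => (tau w <= t%:E)%E).
Proof. exact: measurable_fun_lee. Qed.

Lemma measurable_wrt_jump_filtration (X : T -> R) t c :
  measurable_fun setT X -> (forall w, before tau t w -> X w = c) ->
  measurable_wrt (F t) X.
Proof.
move=> mX Xc B mB; split; first by rewrite -[_ @^-1` _]setTI; exact: mX.
have [Bc|NBc] := pselect (B c); [right|left].
  rewrite (_ : _ `&` _ = set0); first exact: negligible_set0.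
  by rewrite -subset0 => w [/= NBw /Xc Xw]; apply: NBw; rewrite /= Xw.
rewrite (_ : _ `&` _ = set0); first exact: negligible_set0.
by rewrite -subset0 => w [/= Bw /Xc Xw]; apply: NBc; rewrite -Xw.
Qed.

(** Given the events of time s, a variable X is completely known on {tau <= s},
    while {s < tau} is an atom up to null sets, on which X is averaged. *)
Lemma is_condexp_jump_filtration (X : T -> R) s :
  P.-integrable setT (EFin \o X) ->
  is_condexp P (F s) X (fun w => if (tau w <= s%:E)%E then X w else
    fine (\int[P]_(w in before tau s) (X w)%:E) / fine (P (before tau s))).
Proof.
move=> iX; have mX : measurable_fun setT X.
  by case/integrableP : iX => /measurable_EFinP.
set c := _ / _; set C := fun w => _.
have mb := measurable_before s.
have CB w : before tau s w -> C w = c by rewrite /before/= /C ltNge => /negbTE ->.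
have CNB w : ~ before tau s w -> C w = X w.
  by rewrite /before/= /C => /negP; rewrite -leNgt => ->.
have mC : measurable_fun setT C.
  by apply: measurable_fun_ifT => //; exact: measurable_fun_tau_le.
have iC : P.-integrable setT (EFin \o C).
  apply: (@le_integrable _ _ _ P setT measurableT _
    (fun w => (`|X w| + `|c|)%:E)).
  - exact/measurable_EFinP.
  - move=> w _ /=; rewrite lee_fin [leRHS]ger0_norm ?addr_ge0//.
    by rewrite /C; case: ifP => _; rewrite ?lerDl ?lerDr.
  - under eq_fun do rewrite EFinD.
    apply: integrableD => //; first exact: integrable_norm iX.
    exact: (finite_measure_integrable_cst P `|c|).
(* If the jump almost surely occurs by time s, then both sides vanish and the
   quotient defining c is 0 / 0 = 0. *)
have IC : (\int[P]_(w in before tau s) (C w)%:E =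
           \int[P]_(w in before tau s) (X w)%:E)%E.
  rewrite (eq_integral (cst c%:E)); last by move=> w /[!inE] /CB /= ->.
  rewrite integral_cst//= -(fineK (fin_num_measure P _ mb)) -EFinM.
  have [P0|P0] := eqVneq (fine (P (before tau s))) 0; last first.
    by rewrite divfK// fineK// integrable_fin_num//; exact: integrableS iX.
  have Pb0 : P (before tau s) = 0%E.
    by rewrite -(fineK (fin_num_measure P _ mb)) P0.
  rewrite P0 mulr0; symmetry.
  rewrite (@negligible_integral _ _ _ P (before tau s) (before tau s))//.
    by rewrite setDv integral_set0.
  exact: integrableS iX.
split=> [||B [mB HB]]; [exact: measurable_wrt_jump_filtration CB|exact: iC|].
have split_int (f : T -> R) : P.-integrable setT (EFin \o f) ->
    (\int[P]_(w in B) (f w)%:E = \int[P]_(w in B `&` before tau s) (f w)%:E +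
                                 \int[P]_(w in B `\` before tau s) (f w)%:E)%E.
  move=> /integrableP[mf _].
  rewrite -[in LHS](setUIDK B (before tau s)) integral_setU//.
  - exact: measurableI.
  - exact: measurableD.
  - exact: measurable_funS mf.
  - by apply/disj_setPS => w [[_ ?] []].
rewrite (split_int C)// (split_int X)//; congr (_ + _)%E; last first.
  by apply: eq_integral => w /[!inE] -[_ /CNB ->].
have mBb : measurable (B `&` before tau s) by exact: measurableI.
have mNBb : measurable (~` B `&` before tau s).
  by apply: measurableI => //; exact: measurableC.
case: HB => /measure_negligible P0.
  rewrite !(@negligible_integral _ _ _ P (B `&` before tau s)
                                         (B `&` before tau s))//.
  - by rewrite setDv !integral_set0.
  - exact: integrableS iX.
  - exact: P0.
  - exact: integrableS iC.
  - exact: P0.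
have -> : B `&` before tau s = before tau s `\` (~` B `&` before tau s).
  by rewrite setDIr setDv setU0 setDE setCK setIC.
by rewrite -!negligible_integral//; [exact: integrableS iX|exact: P0
  |exact: integrableS iC|exact: P0].
Qed.

End conditional_expectation.

(** * Supermartingales with a single jump *)

Section single_jump.
Context d (T : measurableType d) (R : realType) (P : probability T R).
Variables (tau : T -> \bar R) (jump : T -> R).
Hypothesis mtau : measurable_fun setT tau.
Hypothesis mjump : measurable_fun setT jump.
Hypothesis jump_ge0 : forall w, 0 <= jump w.

Let F := jump_filtration P tau.

Definition jumped (t : R) (w : T) : R :=
  if (tau w <= t%:E)%E then jump w else 0.

Lemma measurable_jumped t : measurable_fun setT (jumped t).
Proof. by apply: measurable_fun_ifT => //; exact: measurable_fun_tau_le. Qed.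

Lemma jumped_ge0 t w : 0 <= jumped t w.
Proof. by rewrite /jumped; case: ifP. Qed.

Lemma jumped_before t w : before tau t w -> jumped t w = 0.
Proof. by rewrite /before /jumped /= ltNge => /negbTE ->. Qed.

Lemma jumped_after s t w : s <= t -> ~ before tau s w -> jumped t w = jump w.
Proof.
rewrite /before/jumped/= => st /negP; rewrite -leNgt => ts.
by rewrite (le_trans ts)// lee_fin.
Qed.

Lemma adapted_jumped (beta : R -> R) :
  adapted F (fun t w => jumped t w - beta t).
Proof.
move=> t _; apply: (@measurable_wrt_jump_filtration _ _ _ _ _ _ _ (- beta t)).
  by apply: measurable_funB => //; exact: measurable_jumped.
by move=> w /jumped_before ->; rewrite sub0r.
Qed.

(** After the jump the increments are those of -beta.  Before it, the only
    conditional expectation to control is the mean over the atom {s < tau}, to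
    which the jump contributes its integral over {s < tau <= t}. *)
Lemma supermartingale_jumped (beta M : R -> R) :
  (forall (t : R) w, 0 <= t -> (tau w <= t%:E)%E -> jump w <= M t) ->
  (forall s t : R, 0 <= s -> s <= t -> beta s <= beta t) ->
  (forall s t : R, 0 <= s -> s <= t ->
     (\int[P]_(w in before tau s `&` [set w | tau w <= t%:E]) (jump w)%:E <=
      (beta t - beta s)%:E * P (before tau s))%E) ->
  supermartingale P F (fun t w => jumped t w - beta t).
Proof.
move=> jumpM nd_beta compensated.
have iJ (t : R) : 0 <= t -> P.-integrable setT (EFin \o jumped t).
  move=> t0; apply: measurable_bounded_integrable => //.
  - exact: fin_num_fun_lty.
  - exact: measurable_jumped.
  - exists `|M t|; split; first exact: num_real.
    move=> x Mx w _ /=; rewrite ger0_norm ?jumped_ge0// (le_trans _ (ltW Mx))//.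
    rewrite /jumped; case: ifPn => // /(jumpM _ _ t0)/le_trans; apply.
    exact: ler_norm.
have iZ (t : R) : 0 <= t ->
    P.-integrable setT (EFin \o (fun w => jumped t w - beta t)).
  move=> t0.
  rewrite (_ : _ \o _ = ((EFin \o jumped t) \- (EFin \o cst (beta t)))%E)//.
  apply: integrableB => //; first exact: iJ.
  exact: finite_measure_integrable_cst.
split=> // [|s t s0 st]; first exact: adapted_jumped.
have t0 : 0 <= t by exact: le_trans st.
pose X w := jumped t w - beta t - (jumped s w - beta s).
have iX : P.-integrable setT (EFin \o X).
  exact: (integrableB measurableT (iZ t t0) (iZ s s0)).
have mb := measurable_before mtau s.
eexists; first exact: is_condexp_jump_filtration iX.
apply: aeW => w; case: ifPn => [ts|_].
  have Nb : ~ before tau s w by apply/negP; rewrite -leNgt.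
  have -> : X w = beta s - beta t.
    by rewrite /X (jumped_after st Nb) (jumped_after (lexx s) Nb); ring.
  by rewrite subr_le0 nd_beta.
apply: mulr_le0_ge0; last by rewrite invr_ge0 fine_ge0.
apply: fine_le0.
rewrite (eq_integral (fun w => (jumped t w)%:E - (beta t - beta s)%:E)%E);
  last first.
  move=> v /[!inE] /jumped_before Jv.
  by rewrite /X Jv -EFinB; congr (_%:E); ring.
rewrite integralB_EFin//; last 2 first.
- by apply: integrableS (iJ t t0).
- exact: finite_measure_integrable_cst.
rewrite integral_cst// sube_le0.
apply: le_trans (compensated s t s0 st).
rewrite [leRHS]integral_mkcondr le_eqVlt; apply/predU1P; left.
apply: eq_integral => v _; rewrite patchE /jumped.
case: ifPn => tv; first by rewrite mem_set.
by rewrite memNset//=; exact/negP.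
Qed.

End single_jump.

(** * Paths of a single jump with a continuous drift *)

Section paths.
Context d (T : measurableType d) (R : realType) (P : probability T R).
Variables (tau : T -> \bar R) (jump : T -> R) (b : R -> R).
Hypothesis mtau : measurable_fun setT tau.
Hypothesis mjump : measurable_fun setT jump.
Hypothesis jump_ge0 : forall w, 0 <= jump w.
Hypothesis nd_b : {homo b : x y / x <= y}.
Hypothesis cb : continuous b.

Let F := jump_filtration P tau.
Let N := jumped tau jump.

Lemma jumped_nondecreasing w : {homo N ^~ w : s t / s <= t}.
Proof.
move=> s t st; rewrite /N /jumped; case: ifPn => [ts|_].
  by rewrite (le_trans ts)// lee_fin.
by case: ifP.
Qed.

Lemma cadlag_jumped : cadlag_process (fun t w => N t w - b t).
Proof.
move=> w; split=> t t0.
  apply: cvgB; last exact/cvg_at_right_filter/cb.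
  apply: cvg_near_cst; rewrite /N /jumped.
  have [ts|st] := leP (tau w) t%:E.
    near=> x; rewrite ifT// (le_trans ts)// lee_fin.
    exact/ltW.
  case tauw: (tau w) st => [r| |]// st.
    near=> x; rewrite ifF// lee_fin; apply/negbTE; rewrite -ltNge.
    by near: x; exact: nbhs_right_lt.
  by near=> x.
have [ts|st] := ltP (tau w) t%:E.
  exists (jump w - b t); apply: cvgB; last exact/cvg_at_left_filter/cb.
  apply: cvg_near_cst; rewrite /N /jumped.
  case tauw: (tau w) ts => [r| |]// ts.
    near=> x; rewrite ifT// lee_fin; apply: ltW.
    by near: x; exact: nbhs_left_gt.
  by near=> x; rewrite ifT// leNye.
exists (0 - b t); apply: cvgB; last exact/cvg_at_left_filter/cb.
apply: cvg_near_cst; rewrite /N /jumped.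
near=> x; rewrite ifF//; apply/negbTE; rewrite -ltNge (lt_le_trans _ st)//.
by rewrite lte_fin.
Unshelve. all: by end_near. Qed.

(** The paths have finite variation, as differences of nondecreasing functions,
    so that the local martingale part can be taken to be zero. *)
Lemma semimartingale_jumped : semimartingale P F (fun t w => N t w - b t).
Proof.
split; first exact: cadlag_jumped.
exists (fun _ _ => 0), (fun t w => N t w - b t).
have FA (c t : R) : measurable_wrt (F t) (fun _ : T => c).
  by apply: (@measurable_wrt_jump_filtration _ _ _ _ _ _ _ c).
split=> [||t w _]; last by rewrite add0r.
- split; first by move=> w; split=> [t t0|t t0]; [|exists 0]; exact: cvg_cst.
  split; first by move=> t _; exact: FA.
  exists (fun _ _ => +oo%E); split.
  + split=> // t _; rewrite (_ : [set _ | _] = set0).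
      by case: (jump_filtration_sigma_algebra P tau t).
    by rewrite -subset0 => w /=; rewrite leye_eq.
  + by [].
  + by apply: aeW => w; exact: cvg_cst.
  + move=> n; split.
    * by move=> t _; exact: (FA (0 - 0)).
    * by move=> t _; exact: (finite_measure_integrable_cst P (0 - 0)).
    * move=> s t _ _; split=> //; first exact: (FA (0 - 0)).
      exact: (finite_measure_integrable_cst P (0 - 0)).
- split; first exact: cadlag_jumped.
    exact: adapted_jumped.
  move=> w t; rewrite le_eqVlt => /predU1P[<-|t0].
    exact: bounded_variationxx.
  apply: (bounded_variationD (g := \- b)) => //.
    apply: nondecreasing_bounded_variation => x y _ _.
    exact: jumped_nondecreasing.
  apply: bounded_variationN.
  by apply: nondecreasing_bounded_variation => x y _ _; exact: nd_b.
Qed.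

(** Every increment of a single-jump path is either zero or the whole jump. *)
Lemma sqr_increment_jumped w s t : s <= t ->
  (N t w - N s w) ^+ 2 = jump w * (N t w - N s w).
Proof.
move=> st; have := jumped_nondecreasing w st.
rewrite /N /jumped; case: ifPn; case: ifPn => _ _ Hle; try by ring.
have /eqP -> : jump w == 0 by rewrite eq_le Hle jump_ge0.
by ring.
Qed.

(** Subtracting jump times the increment of the jump path, which telescopes,
    leaves in each term (Db)^2 - 2 DN Db, where DN and Db are the increments of
    the jump path and of b; when every Db is at most e, these terms add up to at
    most e times the total increments. *)
Lemma sum_sq_increments_jumped w t (s : seq R) e :
  itv_partition 0 t s ->
  (forall i, (i < size s)%N ->
     b (nth 0 (0 :: s) i.+1) - b (nth 0 (0 :: s) i) <= e) ->
  `|sum_sq_increments (fun t w => N t w - b t) s w - jump w * (N t w - N 0 w)|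
    <= e * (2 * (N t w - N 0 w) + (b t - b 0)).
Proof.
move=> st be; have [/(pathP 0) lt_s _] := st.
pose p i := nth 0 (0 :: s) i.
have tel (f : R -> R) : \sum_(i < size s) (f (p i.+1) - f (p i)) = f t - f 0.
  rewrite -(big_mkord xpredT (fun i => f (p i.+1) - f (p i))).
  by rewrite telescope_sumr// /p (itv_partition_nth_size _ st).
rewrite -(tel (N ^~ w)) -(tel b) !mulr_sumr -big_split/= mulr_sumr.
rewrite /sum_sq_increments -sumrB; apply: le_trans (ler_norm_sum _ _ _) _.
apply: ler_sum => i _; rewrite -!/(p _).
have pS : p i <= p i.+1 by apply/ltW/lt_s.
rewrite -(sqr_increment_jumped w pS).
have DN : 0 <= N (p i.+1) w - N (p i) w.
  by rewrite subr_ge0; exact: jumped_nondecreasing.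
have Db : 0 <= b (p i.+1) - b (p i) by rewrite subr_ge0; exact: nd_b.
have Dbe := be i (ltn_ord i); rewrite -!/(p _) in Dbe.
set x := N (p i.+1) w in DN *; set y := N (p i) w in DN *.
set u := b (p i.+1) in Db Dbe *; set v := b (p i) in Db Dbe *.
rewrite (_ : _ - _ = (u - v) * ((u - v) - 2 * (x - y))); last by ring.
rewrite normrM (ger0_norm Db) ler_pM//.
by apply: le_trans (ler_normB _ _) _; rewrite !ger0_norm ?mulr_ge0// addrC.
Qed.

(** The error bound is uniform on the probability space, so that the exceptional
    events of the convergence in probability are eventually empty. *)
Lemma quadratic_variation_jumped (M : R -> R) :
  (forall (t : R) w, 0 <= t -> (tau w <= t%:E)%E -> jump w <= M t) ->
  (forall w, N 0 w = 0) ->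
  (forall e : R, 0 < e -> exists2 h : R, 0 < h &
     forall x y : R, 0 <= x -> x <= y -> y - x <= h -> b y - b x <= e) ->
  is_quadratic_variation P (fun t w => N t w - b t)
    (jumped tau (fun w => jump w ^+ 2)).
Proof.
move=> jumpM N0 ub; split.
- by move=> t _; apply: measurable_jumped => //; exact: measurable_funX.
- move=> w s t _ st; rewrite /jumped; case: ifPn => [ts|_].
    by rewrite (le_trans ts)// lee_fin.
  by case: ifP => // _; exact: sqr_ge0.
move=> t pi t0 ppi mpi eps eps0.
have M0 w : 2 * N t w + (b t - b 0) <= 2 * `|M t| + (b t - b 0).
  rewrite lerD2r ler_pM2l// /N /jumped; case: ifPn => // /(jumpM _ _ t0)/le_trans.
  by apply; exact: ler_norm.
have K0 : 0 <= 2 * `|M t| + (b t - b 0).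
  by rewrite addr_ge0 ?mulr_ge0// subr_ge0 nd_b.
set K := 2 * _ + _ in M0 K0.
have [|h h0 hb] := ub (eps / (K + 1)); first by rewrite divr_gt0// ltr_wpDl.
apply: cvg_near_cst.
have : \forall n \near \oo, mesh (pi n) < h.
  by apply: cvgr_lt mpi _ h0.
apply: filterS => n mh.
rewrite (_ : [set _ | _] = set0) ?measure0// -subset0 => w /=.
apply/negP; rewrite -leNgt.
have Q : jumped tau (fun w => jump w ^+ 2) t w = jump w * (N t w - N 0 w).
  by rewrite N0 subr0 /N /jumped; case: ifP; rewrite ?mulr0// expr2.
rewrite Q.
apply: le_trans (sum_sq_increments_jumped (e := eps / (K + 1)) _ (ppi n) _) _.
  move=> i ni; have [/(pathP 0) lt_s _] := ppi n.
  apply: hb; last first.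
    apply: le_trans (ltW mh); rewrite /mesh.
    apply: le_trans (ler_norm _) _.
    exact: (le_bigmax _ (fun i : 'I_(size (pi n)) =>
      `|nth 0 (0 :: pi n) i.+1 - nth 0 (0 :: pi n) i|) (Ordinal ni)).
    exact/ltW/lt_s.
  have := itv_partition_nth_ge (m := i) (ltnW ni) (ppi n).
  by rewrite (set_nth_default 0)// ltnW.
rewrite N0 subr0 mulrAC ler_pdivrMr ?ltr_wpDl// ler_pM2l//.
by rewrite (le_trans (M0 w))// lerDl.
Qed.

End paths.

Section supremum.
Context d (T : measurableType d) (R : realType).
Variables (tau : T -> \bar R) (jump : T -> R) (b : R -> R).
Hypothesis nd_b : {homo b : x y / x <= y}.
Hypothesis b0 : b 0 = 0.

Let Y t w := jumped tau jump t w - b t.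

Lemma Ysup_jumped_never w : tau w = +oo%E -> Ysup Y w = 0%E.
Proof.
move=> tauw; apply/eqP; rewrite eq_le; apply/andP; split.
  apply: ge_ereal_sup => _ [t /= t0 <-].
  by rewrite lee_fin /Y /jumped tauw/= sub0r oppr_le0 -b0 nd_b.
apply: ereal_sup_ubound; exists 0; first exact: lexx.
by rewrite /Y /jumped tauw b0 subr0.
Qed.

(** The supremum is reached at the jump, provided that the jump makes up for the
    decrease -b that precedes it. *)
Lemma Ysup_jumped_at w r : tau w = r%:E -> 0 <= r -> b r <= jump w ->
  Ysup Y w = (jump w - b r)%:E.
Proof.
move=> tauw r0 br; apply/eqP; rewrite eq_le; apply/andP; split.
  apply: ge_ereal_sup => _ [t /= t0 <-].
  rewrite lee_fin /Y /jumped tauw lee_fin; case: ifPn => [rt|_].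
    by rewrite lerB// nd_b.
  by rewrite sub0r (@le_trans _ _ 0)// ?oppr_le0 ?subr_ge0// -b0 nd_b.
apply: ereal_sup_ubound; exists r => //.
by rewrite /Y /jumped tauw lexx.
Qed.

End supremum.

(** * Integrals bounded through antiderivatives *)

Lemma integral_derivative (R : realType) (g G : R -> R) (a b : R) :
  a < b ->
  (forall x, a <= x <= b -> is_derive x 1 G (g x)) ->
  (forall x, a <= x <= b -> {for x, continuous g}) ->
  (\int[lebesgue_measure]_(x in `[a, b]) (g x)%:E = (G b - G a)%:E)%E.
Proof.
move=> ab dG cg.
have cG x : a <= x <= b -> {for x, continuous G}.
  move=> axb; apply: differentiable_continuous; apply/derivable1_diffP.
  by have [] := dG x axb.
rewrite EFinB -(@continuous_FTC2 _ g G)//.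
- by apply: continuous_in_subspaceT => x /[!inE]/=; rewrite in_itv/=; exact: cg.
- split=> [x||].
  + by rewrite in_itv/= => /andP[ax xb]; have [] := dG x; rewrite ?ltW.
  + by apply: cvg_at_right_filter; apply: cG; rewrite lexx ltW.
  + by apply: cvg_at_left_filter; apply: cG; rewrite lexx ltW.
- move=> x; rewrite in_itv/= => /andP[ax xb].
  have H : is_derive x 1 G (g x) by apply: dG; rewrite !ltW.
  by rewrite derive1E derive_val.
Qed.

Lemma integral_le_increment (R : realType) (f g G : R -> R) (a b : R) :
  a <= b -> measurable_fun setT f ->
  (forall x, a <= x <= b -> 0 <= f x <= g x) ->
  (forall x, a <= x <= b -> is_derive x 1 G (g x)) ->
  (forall x, a <= x <= b -> {for x, continuous g}) ->
  (\int[lebesgue_measure]_(x in `[a, b[) (f x)%:E <= (G b - G a)%:E)%E.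
Proof.
rewrite le_eqVlt => /predU1P[<-|ab] mf fg dG cg.
  by rewrite set_itvco0 integral_set0 subrr.
rewrite -(integral_derivative ab dG cg).
have mfE A : measurable_fun A (fun x => (f x)%:E).
  by apply/measurable_EFinP; exact: measurable_funTS.
apply: (@le_trans _ _ (\int[lebesgue_measure]_(x in `[a, b]) (f x)%:E)%E).
  apply: ge0_subset_integral => //; first exact: mfE.
    by move=> x /=; rewrite in_itv/= lee_fin => /fg/andP[].
  exact: subset_itv_co_cc.
apply: ge0_le_integral => //.
- by move=> x /=; rewrite in_itv/= lee_fin => /fg/andP[].
- exact: mfE.
- apply/measurable_EFinP; apply: subspace_continuous_measurable_fun => //.
  by apply: continuous_in_subspaceT => x /[!inE]/=; rewrite in_itv/=; exact: cg.
- by move=> x /=; rewrite in_itv/= lee_fin => /fg/andP[].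
Qed.

(** * The law of the clock *)

Section law.
Context (R : realType).
Implicit Types (x s t : R).

(** The variable w = 1 + sqrt tau as a function of the value x of U. *)
Definition level x : R := (Num.sqrt (5 * x))^-1.

Definition rings x : bool := (0 < x <= 5^-1).

(** The value of U for which the clock rings at time t: the larger U, the
    earlier the clock rings. *)
Definition cut t : R := (5 * (1 + Num.sqrt t) ^+ 2)^-1.

Definition ring_time x : \bar R :=
  if rings x then ((level x - 1) ^+ 2)%:E else +oo%E.

Definition jump_size x : R :=
  if rings x then (level x - 1) * (2 * level x + 1) else 0.

Lemma sqrt_mul5_gt0 x : 0 < x -> 0 < Num.sqrt (5 * x).
Proof. by move=> x0; rewrite sqrtr_gt0 mulr_gt0. Qed.

Lemma level_gt0 x : 0 < x -> 0 < level x.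
Proof. by move=> x0; rewrite invr_gt0 sqrt_mul5_gt0. Qed.

Lemma level_sqr x : 0 < x -> level x ^+ 2 = (5 * x)^-1.
Proof. by move=> x0; rewrite exprVn sqr_sqrtr// mulr_ge0// ltW. Qed.

Lemma rings_level x : rings x -> 1 <= level x.
Proof.
move=> /andP[x0 x5]; rewrite -(@ler_pXn2r _ 2)// ?nnegrE ?(ltW (level_gt0 x0))//.
rewrite expr1n level_sqr// invf_ge1 ?mulr_gt0//.
by rewrite mulrC -ler_pdivlMr// mul1r.
Qed.

Lemma cut_gt0 t : 0 < cut t.
Proof. by rewrite invr_gt0 mulr_gt0// exprn_gt0// ltr_pwDl// sqrtr_ge0. Qed.

Lemma level_cut t : level (cut t) = 1 + Num.sqrt t.
Proof.
have h : 0 < 1 + Num.sqrt t by rewrite ltr_pwDl// sqrtr_ge0.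
by rewrite /level /cut invfM mulrA divff// mul1r -exprVn sqrtr_sqr ger0_norm
  ?invrK// invr_ge0 ltW.
Qed.

Lemma le_cut s t : s <= t -> cut t <= cut s.
Proof.
move=> st; rewrite lef_pV2 ?posrE ?mulr_gt0 ?exprn_gt0 ?ltr_pwDl ?sqrtr_ge0//.
rewrite ler_pM2l// ler_pXn2r// ?nnegrE ?addr_ge0 ?sqrtr_ge0//.
by rewrite lerD2l ler_wsqrtr.
Qed.

Lemma cut0 : cut 0 = 5^-1.
Proof. by rewrite /cut sqrtr0 addr0 expr1n mulr1. Qed.

Lemma rings_cut t x : cut t <= x <= 5^-1 -> rings x.
Proof.
by move=> /andP[tx x5]; rewrite /rings x5 andbT (lt_le_trans (cut_gt0 t)).
Qed.

Lemma le_level_cut t x : 0 < x -> (level x <= 1 + Num.sqrt t) = (cut t <= x).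
Proof.
move=> x0; have h : 0 < 1 + Num.sqrt t by rewrite ltr_pwDl// sqrtr_ge0.
rewrite -(@ler_pXn2r _ 2)// ?nnegrE ?(ltW h) ?(ltW (level_gt0 x0))// level_sqr//.
rewrite -[in RHS](invrK x) lef_pV2 ?posrE ?invr_gt0 ?mulr_gt0 ?exprn_gt0//.
by rewrite invfM mulrC ler_pdivrMr// mulrC.
Qed.

Lemma ring_time_le t x : 0 <= t -> (ring_time x <= t%:E)%E = (cut t <= x <= 5^-1).
Proof.
move=> t0; rewrite /ring_time; case: ifPn => fx.
  have /andP[x0 x5] := fx; have lx := rings_level fx.
  rewrite x5 andbT -le_level_cut// lee_fin -lerBlDl.
  by rewrite -{1}(sqr_sqrtr t0) ler_pXn2r// ?nnegrE ?subr_ge0 ?sqrtr_ge0.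
apply/esym/negbTE; apply: contra fx; exact: rings_cut.
Qed.

Lemma jump_size_ge0 x : 0 <= jump_size x.
Proof.
rewrite /jump_size; case: ifPn => // /rings_level lx.
by rewrite mulr_ge0 ?subr_ge0//; lra.
Qed.

Lemma jump_size_le t x : 0 <= t -> (ring_time x <= t%:E)%E ->
  jump_size x <= Num.sqrt t * (2 * (1 + Num.sqrt t) + 1).
Proof.
move=> t0; rewrite ring_time_le// => ctx; have fx := rings_cut ctx.
have /andP[x0 _] := fx; have lx := rings_level fx.
have {ctx} : level x <= 1 + Num.sqrt t by rewrite le_level_cut//; case/andP: ctx.
rewrite /jump_size fx => ls; apply: ler_pM; lra.
Qed.

Lemma is_derive_level x : 0 < x ->
  is_derive x 1 level (- (5 / 2) * level x ^+ 3).
Proof.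
move=> x0; have s0 := sqrt_mul5_gt0 x0.
have d5 : is_derive x 1 ( *%R 5) (5 : R).
  rewrite -[X in is_derive _ _ _ X]mulr1.
  exact: (is_deriveZ 5 (is_derive_id x 1)).
have ds : is_derive x 1 (Num.sqrt \o *%R 5) ((2 * Num.sqrt (5 * x))^-1 * 5).
  apply: is_derive1_comp.
  by apply: is_derive1_sqrt; rewrite mulr_gt0.
have := @is_deriveV _ (Num.sqrt \o *%R 5) x _ 1 _ ds.
rewrite /= => /(_ (lt0r_neq0 s0)) H.
apply: is_derive_eq.
rewrite /level /GRing.scale/= invfM.
field; exact: lt0r_neq0.
Qed.

Lemma continuous_level x : 0 < x -> {for x, continuous level}.
Proof.
move=> x0; apply: differentiable_continuous; apply/derivable1_diffP.
by have [] := is_derive_level x0.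
Qed.

Lemma continuous_levelX n x : 0 < x -> {for x, continuous (fun y => level y ^+ n)}.
Proof.
move=> x0; apply: (@continuous_comp _ _ _ level (fun y => y ^+ n)).
  exact: continuous_level.
exact: exprn_continuous.
Qed.

Lemma measurable_rings : measurable [set x | rings x].
Proof.
by rewrite (_ : [set x | _] = `]0, 5^-1]%classic).
Qed.

Lemma measurable_level : measurable_fun [set x | rings x] level.
Proof.
have sub : [set x | rings x] `<=` `]0, +oo[.
  by move=> x /= /andP[x0 _]; rewrite in_itv/= x0.
apply: measurable_funS sub _ => //.
apply: open_continuous_measurable_fun; first exact: interval_open.
by move=> x /[!inE]/=; rewrite in_itv/= andbT; exact: continuous_level.
Qed.

Lemma measurable_rings_if d' (T' : measurableType d') (f : R -> T') (c : T') :
  measurable_fun [set x | rings x] f ->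
  measurable_fun setT (fun x => if rings x then f x else c).
Proof.
move=> mf; apply: measurable_fun_if => //.
- apply: (@measurable_fun_bool _ _ _ _ true).
  by rewrite setTI; exact: measurable_rings.
- by rewrite setTI.
Qed.

Lemma measurable_ring_time : measurable_fun setT ring_time.
Proof.
apply: measurable_rings_if; apply/measurable_EFinP.
by apply: measurable_funX; apply: measurable_funB => //; exact: measurable_level.
Qed.

Lemma measurable_jump_size : measurable_fun setT jump_size.
Proof.
apply: measurable_rings_if; apply: measurable_funM.
  by apply: measurable_funB => //; exact: measurable_level.
apply: measurable_funD => //; apply: measurable_funM => //.
exact: measurable_level.
Qed.

Let cut_itv s t x : 0 <= s -> cut t <= x <= cut s -> rings x.
Proof.
move=> s0 /andP[tx xs]; rewrite /rings (lt_le_trans (cut_gt0 t) tx)/=.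
by rewrite (le_trans xs)// -cut0 le_cut.
Qed.

(** The jump is dominated by the derivative of -4/5 level, and level (cut t) is
    1 + sqrt t. *)
Lemma integral_jump_size_le s t : 0 <= s -> s <= t ->
  (\int[lebesgue_measure]_(x in `[cut t, cut s[) (jump_size x)%:E <=
    (4 / 5 * (Num.sqrt t - Num.sqrt s))%:E)%E.
Proof.
move=> s0 st.
pose G x := - (4 / 5) * level x.
pose g x := 2 * level x ^+ 3.
apply: (@le_trans _ _ (G (cut s) - G (cut t))%:E); last first.
  by rewrite /G !level_cut lee_fin le_eqVlt; apply/predU1P; left; ring.
apply: (integral_le_increment (g := g)).
- exact: le_cut.
- exact: measurable_jump_size.
- move=> x /(cut_itv s0) fx; rewrite jump_size_ge0 /jump_size fx /g/=.
  (* (w - 1) (2 w + 1) <= 2 w^3 for w >= 1. *)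
  have := rings_level fx; set w := level x => w1.
  by nra.
- move=> x /(cut_itv s0) /andP[x0 _].
  rewrite (_ : g x = - (4 / 5) *: (- (5 / 2) * level x ^+ 3)); last first.
    by rewrite /g /GRing.scale/=; field.
  exact: (is_deriveZ _ (is_derive_level x0)).
- move=> x /(cut_itv s0) /andP[x0 _].
  apply: continuousM; first exact: cst_continuous.
  exact: continuous_levelX.
Qed.

(** The same with -4/5 (level - 1)^2, since (level (cut t) - 1)^2 = t. *)
Lemma integral_jump_size_sqr_le s t : 0 <= s -> s <= t ->
  (\int[lebesgue_measure]_(x in `[cut t, cut s[) (jump_size x ^+ 2)%:E <=
    (4 / 5 * (t - s))%:E)%E.
Proof.
move=> s0 st; have t0 := le_trans s0 st.
pose l1 : R -> R := level \- cst 1.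
pose G x := - (4 / 5) * l1 x ^+ 2.
pose g x := 4 * l1 x * level x ^+ 3.
apply: (@le_trans _ _ (G (cut s) - G (cut t))%:E); last first.
  have l1_cut r : l1 (cut r) = Num.sqrt r.
    by rewrite /l1/= level_cut addrAC subrr add0r.
  rewrite /G !l1_cut lee_fin !sqr_sqrtr//.
  by rewrite le_eqVlt; apply/predU1P; left; ring.
apply: (integral_le_increment (g := g)).
- exact: le_cut.
- by apply: measurable_funX; exact: measurable_jump_size.
- move=> x /(cut_itv s0) fx; rewrite sqr_ge0 /jump_size fx /g /l1/=.
  have := rings_level fx; set w := level x => w1.
  rewrite -subr_ge0.
  rewrite [leRHS](_ : _ = (w - 1) * (3 * w + 1)); last by ring.
  by rewrite mulr_ge0//; lra.
- move=> x /(cut_itv s0) /andP[x0 _].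
  have d1 := is_deriveB (is_derive_level x0) (is_derive_cst (1 : R) x 1).
  have d2 := is_deriveZ (- (4 / 5)) (is_deriveX 2 d1).
  rewrite (_ : g x = - (4 / 5) *:
    ((2 * l1 x ^+ 1) *: (- (5 / 2) * level x ^+ 3 - 0))); first exact: d2.
  by rewrite /g /GRing.scale/=; field.
- move=> x /(cut_itv s0) /andP[x0 _].
  have cl := continuous_level x0.
  apply: continuousM; last exact: continuous_levelX.
  apply: continuousM; first exact: cst_continuous.
  by apply: continuousB => //; exact: cst_continuous.
Qed.

(** The level (2 tau + 3 sqrt tau) - (tau + sqrt tau) = w^2 - 1 that the path
    reaches at its jump. *)
Definition path_sup x : R := if rings x then level x ^+ 2 - 1 else 0.

Lemma measurable_path_sup : measurable_fun setT path_sup.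
Proof.
apply: measurable_rings_if; apply: measurable_funB => //.
by apply: measurable_funX; exact: measurable_level.
Qed.

Lemma path_sup_ge0 x : 0 <= path_sup x.
Proof.
rewrite /path_sup; case: ifPn => // /rings_level lx.
by rewrite subr_ge0 exprn_ege1.
Qed.

Lemma path_sup_ge a x : 0 <= a -> 0 < x <= (5 * (1 + a))^-1 -> a <= path_sup x.
Proof.
move=> a0 /andP[x0 xa]; have a1 : 0 < 1 + a by rewrite ltr_pwDl.
have fx : rings x.
  rewrite /rings x0 (le_trans xa)// lef_pV2 ?posrE ?mulr_gt0//.
  by rewrite ler_peMr// lerDl.
rewrite /path_sup fx level_sqr// lerBrDl -[leLHS]invrK.
rewrite lef_pV2 ?posrE ?invr_gt0 ?mulr_gt0//.
by move: xa; rewrite invfM mulrC ler_pdivlMr// mulrC.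
Qed.

(** On ]0, 1/5] the function is 1 / (5 x) - 1, whose integral diverges
    logarithmically at 0. *)
Lemma integral_path_sup :
  (\int[lebesgue_measure]_(x in `[0%R, 1%R]) (path_sup x)%:E = +oo)%E.
Proof.
apply: eq_infty => r.
(* On [e, 5^-1] the integral is (m - 1) / 5 + e, which exceeds `|r|. *)
pose m : R := `|r| * 5 + 1.
have m0 : 0 < m by rewrite ltr_wpDl// mulr_ge0.
pose e : R := 5^-1 * expR (- m).
have e0 : 0 < e by rewrite mulr_gt0// expR_gt0.
have e5 : e < 5^-1 by rewrite gtr_pMr// expR_lt1 oppr_lt0.
pose g (x : R) := 5^-1 * x^-1 - 1.
pose G (x : R) := 5^-1 * ln x - x.
have msup A : measurable_fun A (fun x => (path_sup x)%:E).
  by apply/measurable_EFinP/measurable_funTS; exact: measurable_path_sup.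
have : (\int[lebesgue_measure]_(x in `[e, 5^-1%R]) (path_sup x)%:E <=
        \int[lebesgue_measure]_(x in `[0%R, 1%R]) (path_sup x)%:E)%E.
  apply: ge0_subset_integral => //; first exact: msup.
    by move=> x _; rewrite lee_fin path_sup_ge0.
  move=> x /=; rewrite !in_itv/= => /andP[ex x5].
  by rewrite (le_trans (ltW e0) ex) (le_trans x5)// invf_le1// ler1n.
apply: le_trans.
have -> : (\int[lebesgue_measure]_(x in `[e, 5^-1%R]) (path_sup x)%:E =
           \int[lebesgue_measure]_(x in `[e, 5^-1%R]) (g x)%:E)%E.
  apply: eq_integral => x /[!inE]/=; rewrite in_itv/= => /andP[ex x5].
  have x0 := lt_le_trans e0 ex.
  by rewrite /path_sup /rings x0 x5/= level_sqr// /g invfM.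
have dG x : e <= x <= 5^-1 -> is_derive x 1 G (g x).
  move=> /andP[ex _]; have x0 := lt_le_trans e0 ex.
  exact: (is_deriveB (is_deriveZ 5^-1 (is_derive1_ln x0)) (is_derive_id x (1 : R))).
have cg x : e <= x <= 5^-1 -> {for x, continuous g}.
  move=> /andP[ex _]; have x0 := lt_le_trans e0 ex.
  apply: continuousB; last exact: cst_continuous.
  apply: continuousM; first exact: cst_continuous.
  by apply: continuousV; [rewrite gt_eqF|].
rewrite (integral_derivative e5 dG cg).
rewrite lee_fin /G /e lnM ?posrE ?invr_gt0 ?expR_gt0// expRK.
have := expR_gt0 (- m); have := ler_norm r; rewrite /m.
set E := expR _; lra.
Qed.

End law.

Section uniform_clock.
Context d (T : measurableType d) (R : realType) (P : probability T R).
Variable U : T -> R.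
Hypothesis mU : measurable_fun setT U.
Hypothesis uniform_U : forall (A : set R) (f : R -> \bar R),
  measurable A -> measurable_fun A f -> (forall x, A x -> (0 <= f x)%E) ->
  (\int[P]_(w in U @^-1` A) f (U w) =
   \int[lebesgue_measure]_(x in A `&` `[0%R, 1%R]) f x)%E.

Let tau : T -> \bar R := fun w => ring_time (U w).

Lemma measurable_clock : measurable_fun setT tau.
Proof. exact: measurableT_comp (@measurable_ring_time R) mU. Qed.

Lemma probability_uniform_itv (A : set R) : measurable A -> A `<=` `[0, 1] ->
  P (U @^-1` A) = lebesgue_measure A.
Proof.
move=> mA A01; have mUA : measurable (U @^-1` A).
  by rewrite -[_ @^-1` _]setTI; exact: mU.
have := uniform_U (f := cst 1%E) mA (measurable_cst _) (fun _ _ => lee01).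
by rewrite (setIidl A01) !integral_cst// !mul1e.
Qed.

Lemma before_clockE t : 0 <= t -> before tau t = ~` (U @^-1` `[cut t, 5^-1]).
Proof.
move=> t0; apply/seteqP; split=> w; rewrite /before/= in_itv/= ltNge ring_time_le//.
  by move/negP.
by move=> /negP.
Qed.

Lemma probability_before_clock_ge t : 0 <= t -> ((4 / 5)%:E <= P (before tau t))%E.
Proof.
move=> t0; rewrite before_clockE// probability_setC; last first.
  by rewrite -[_ @^-1` _]setTI; exact: mU.
have c0 := cut_gt0 t.
have c5 : cut t <= 5^-1 by rewrite -(cut0 R) le_cut.
rewrite probability_uniform_itv//; last first.
  move=> x /=; rewrite !in_itv/= => /andP[tx x5].
  by rewrite (le_trans (ltW c0) tx) (le_trans x5)// invf_le1// ler1n.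
rewrite lebesgue_measure_itv/= lte_fin; case: ifPn => _.
  by rewrite -EFinD lee_fin; lra.
by rewrite sube0 lee_fin; lra.
Qed.

(** A bound of the integral over {s < tau <= t} against 4/5 D turns into one
    against D P(s < tau), because the clock fails to ring with probability at
    least 4/5. *)
Lemma integral_clock_le (c D : R) (f : R -> R) s t :
  0 <= s -> s <= t -> 0 <= c -> 0 <= D -> measurable_fun setT f ->
  (forall x, 0 <= f x) ->
  (\int[lebesgue_measure]_(x in `[cut t, cut s[) (f x)%:E <= (4 / 5 * D)%:E)%E ->
  (\int[P]_(w in before tau s `&` [set w | tau w <= t%:E])
      (c * f (U w))%:E <= (c * D)%:E * P (before tau s))%E.
Proof.
move=> s0 st c0 D0 mf f0 fD; have t0 := le_trans s0 st.
have ct0 := cut_gt0 t; have ct := le_cut st.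
have cs5 : cut s <= 5^-1 by rewrite -(cut0 R) le_cut.
have -> : before tau s `&` [set w | (tau w <= t%:E)%E] = U @^-1` `[cut t, cut s[.
  rewrite before_clockE//; apply/seteqP; split=> w /=; rewrite ring_time_le// !in_itv/=.
    by move=> [/negP + /andP[-> x5]]; rewrite x5 andbT ltNge.
  move=> /andP[tw ws]; rewrite tw (ltW (lt_le_trans ws cs5)); split=> //.
  by apply/negP; rewrite andbT -ltNge.
have mfE (A : set R) : measurable_fun A (fun x => (f x)%:E).
  by apply/measurable_EFinP/measurable_funTS.
rewrite (uniform_U (f := fun x => (c * f x)%:E))//; last 2 first.
- apply/measurable_EFinP; apply: measurable_funM => //; exact: measurable_funTS.
- by move=> x _; rewrite lee_fin mulr_ge0.
rewrite setIidl; last first.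
  move=> x /=; rewrite !in_itv/= => /andP[tx xs].
  rewrite (le_trans (ltW ct0) tx) (le_trans (ltW xs))// (le_trans cs5)//.
  by rewrite invf_le1// ler1n.
under eq_integral do rewrite EFinM.
rewrite ge0_integralZl//; last 2 first.
- exact: mfE.
- by move=> x _; rewrite lee_fin.
rewrite EFinM -muleA; apply: lee_wpmul2l; first by rewrite lee_fin.
apply: (le_trans fD); rewrite mulrC EFinM; apply: lee_wpmul2l.
  by rewrite lee_fin.
exact: probability_before_clock_ge.
Qed.

End uniform_clock.

(** * The example *)

Lemma sqrtrB_le (R : rcfType) (x y : R) : 0 <= x -> x <= y ->
  Num.sqrt y - Num.sqrt x <= Num.sqrt (y - x).
Proof.
move=> x0 xy; rewrite lerBlDl.
have yx0 : 0 <= y - x by rewrite subr_ge0.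
rewrite -(@ler_pXn2r _ 2)// ?nnegrE ?addr_ge0 ?sqrtr_ge0//.
rewrite sqrrD !sqr_sqrtr ?(le_trans x0 xy)//.
have : 0 <= Num.sqrt x * Num.sqrt (y - x) by rewrite mulr_ge0 ?sqrtr_ge0.
lra.
Qed.

Lemma uniform_modulus (R : rcfType) (e : R) : 0 < e ->
  exists2 h : R, 0 < h & forall x y : R, 0 <= x -> x <= y -> y - x <= h ->
    y + Num.sqrt y - (x + Num.sqrt x) <= e.
Proof.
move=> e0; pose r := Num.min 1 (e / 2).
have r0 : 0 < r by rewrite lt_min ltr01 divr_gt0.
have r1 : r <= 1 by rewrite ge_min lexx.
have re : r <= e / 2 by rewrite ge_min lexx orbT.
exists (r ^+ 2) => [|x y x0 xy yxr]; first exact: exprn_gt0.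
have : Num.sqrt (y - x) <= r.
  by rewrite -(ger0_norm (ltW r0)) -sqrtr_sqr ler_wsqrtr.
have := sqrtrB_le x0 xy.
have : r ^+ 2 <= r by rewrite expr2 ler_piMl// ltW.
lra.
Qed.

Theorem proposition1p2 (R : realType) (gamma : R) (hgamma : 0 < gamma) :
  exists (d : measure_display) (T : measurableType d) (P : probability T R)
         (F : R -> set_system T) (Y YY : R -> T -> R) (mu sigma2 : R),
    [/\ measure_is_complete P /\ usual_filtration P F,
        [/\ semimartingale P F Y, is_quadratic_variation P Y YY &
            forall w, Y 0 w = 0],
        [/\ 0 < mu, 0 <= sigma2, sigma2 != 0 & gamma = mu / sigma2],
        supermartingale P F (fun t w => Y t w + mu * t) /\
        supermartingale P F (fun t w => YY t w - sigma2 * t) &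
        (forall a : R, 0 <= a ->
           ((1 / (5 * (1 + a * gamma)))%:E
              <= P [set w | (a%:E <= Ysup Y w)%E])%E) /\
        (\int[P]_w Ysup Y w = +oo)%E].
Proof.
have [d [T [P [U [cP mU uU]]]]] := exists_complete_uniform R.
pose k := gamma^-1.
have k0 : 0 < k by rewrite invr_gt0.
pose tau : T -> \bar R := fun w => ring_time (U w).
pose jump w := k * jump_size (U w).
pose b (t : R) : R := k * (t + Num.sqrt t).
have mtau : measurable_fun setT tau by exact: measurable_clock.
have mjump : measurable_fun setT jump.
  by apply: measurable_funM => //; exact: measurableT_comp (@measurable_jump_size R) mU.
have jump_ge0 w : 0 <= jump w by rewrite mulr_ge0 ?jump_size_ge0// ltW.
have nd_b : {homo b : x y / x <= y}.
  by move=> x y xy; rewrite ler_pM2l// lerD// ler_wsqrtr.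
have b0 : b 0 = 0 by rewrite /b sqrtr0 addr0 mulr0.
have cb : continuous b.
  move=> x; apply: cvgM; first exact: cvg_cst.
  by apply: cvgD; [exact: cvg_id|exact: sqrt_continuous].
pose M (t : R) : R := k * (Num.sqrt t * (2 * (1 + Num.sqrt t) + 1)).
have jumpM (t : R) w : 0 <= t -> (tau w <= t%:E)%E -> jump w <= M t.
  by move=> t0 tw; rewrite ler_pM2l// jump_size_le.
have N0 w : jumped tau jump 0 w = 0.
  rewrite /jumped; case: ifPn => // /(jumpM _ _ (lexx 0)).
  rewrite /M sqrtr0 mul0r mulr0 => j0.
  by apply/eqP; rewrite eq_le j0 jump_ge0.
pose Y t w := jumped tau jump t w - b t.
have YsupE w : Ysup Y w = (k * path_sup (U w))%:E.
  rewrite /path_sup; case: ifPn => fx; last first.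
    by rewrite mulr0 Ysup_jumped_never// /tau /= /ring_time (negbTE fx).
  have l1 := rings_level fx.
  have sq : Num.sqrt ((level (U w) - 1) ^+ 2) = level (U w) - 1.
    by rewrite sqrtr_sqr ger0_norm// subr_ge0.
  rewrite (@Ysup_jumped_at _ _ _ _ _ _ nd_b b0 _ ((level (U w) - 1) ^+ 2)).
  - by congr EFin; rewrite /b /jump /jump_size fx sq; ring.
  - by rewrite /tau /= /ring_time fx.
  - exact: sqr_ge0.
  - rewrite /b /jump /jump_size fx sq ler_pM2l//.
    have : 0 <= (level (U w) - 1) * (level (U w) + 1).
      by rewrite mulr_ge0//; lra.
    lra.
exists d, T, P, (jump_filtration P tau), Y, (jumped tau (fun w => jump w ^+ 2)),
  k, (k ^+ 2); split.
- by split=> //; exact: usual_jump_filtration.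
- split; first exact: semimartingale_jumped.
    apply: (quadratic_variation_jumped P mtau mjump jump_ge0 nd_b jumpM N0) => e e0.
    have [|h h0 bh] := uniform_modulus (e := e / k); first exact: divr_gt0.
    exists h => // x y x0 xy yx.
    by rewrite /b -mulrBr mulrC -ler_pdivlMr// bh.
  by move=> w; rewrite /Y N0 b0 subrr.
- split=> //; first exact: sqr_ge0.
    by rewrite expf_neq0// gt_eqF.
  by rewrite expr2 invfM mulrA divff ?gt_eqF// mul1r invrK.
- split.
    (* Adding k t cancels the linear part of b, and k sqrt t remains to
       compensate the jump. *)
    rewrite (_ : (fun t w => _) =
      (fun t w => jumped tau jump t w - k * Num.sqrt t)); last first.
      by apply/funext => t; apply/funext => w; rewrite /Y /b; ring.
    apply: (supermartingale_jumped mtau mjump jump_ge0 jumpM).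
      by move=> s t _ st; rewrite ler_pM2l// ler_wsqrtr.
    move=> s t s0 st; rewrite -mulrBr.
    apply: (integral_clock_le mU uU) => //.
    + exact: ltW.
    + by rewrite subr_ge0 ler_wsqrtr.
    + exact: measurable_jump_size.
    + exact: jump_size_ge0.
    + exact: integral_jump_size_le.
  apply: (@supermartingale_jumped _ _ _ _ _ _ mtau _ _ _ (fun t => M t ^+ 2)).
  + exact: measurable_funX.
  + by move=> w; exact: sqr_ge0.
  + move=> t w t0 tw; rewrite ler_sqr ?nnegrE//.
      exact: jumpM tw.
    by apply: le_trans (jumpM _ _ t0 tw).
  + by move=> s t _ st; rewrite ler_pM2l// exprn_gt0.
  + move=> s t s0 st; rewrite -mulrBr.
    under eq_integral do rewrite exprMn.
    apply: (integral_clock_le mU uU (f := fun x => jump_size x ^+ 2)) => //.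
    * exact: sqr_ge0.
    * by rewrite subr_ge0.
    * by apply: measurable_funX; exact: measurable_jump_size.
    * by move=> x; exact: sqr_ge0.
    * exact: integral_jump_size_sqr_le.
split.
- move=> a a0; set c := 1 / _.
  have ag0 : 0 <= a * gamma by rewrite mulr_ge0// ltW.
  have c0 : 0 < c by rewrite divr_gt0// mulr_gt0// ltr_pwDl.
  have c1 : c <= 1.
    by rewrite /c div1r invf_le1 ?mulr_gt0 ?ltr_pwDl//; lra.
  have msup : measurable [set w | (a%:E <= Ysup Y w)%E].
    rewrite (_ : [set w | _] = [set w | a <= k * path_sup (U w)]); last first.
      by apply/seteqP; split=> w /=; rewrite YsupE lee_fin.
    rewrite -[X in measurable X]setTI.
    apply: measurable_fun_le => //; apply: measurable_funM => //.
    exact: measurableT_comp (@measurable_path_sup R) mU.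
  have -> : c%:E = P (U @^-1` `]0, c]).
    rewrite (probability_uniform_itv mU uU)//.
      by rewrite lebesgue_measure_itv/= lte_fin c0 sube0.
    move=> x /=; rewrite !in_itv/= => /andP[/ltW -> /le_trans]; exact.
  apply: le_measure; rewrite ?inE//.
    by rewrite -[_ @^-1` _]setTI; exact: mU.
  move=> w /=; rewrite in_itv/= YsupE lee_fin => wc.
  rewrite mulrC ler_pdivlMr//; apply: path_sup_ge => //.
  by move: wc; rewrite /c div1r.
under eq_integral do rewrite YsupE EFinM.
have msup (A : set R) : measurable_fun A (fun x => (path_sup x)%:E).
  by apply/measurable_EFinP/measurable_funTS; exact: measurable_path_sup.
rewrite ge0_integralZl//; last 3 first.
- by apply/measurable_EFinP; exact: measurableT_comp (@measurable_path_sup R) mU.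
- by move=> w _; rewrite lee_fin path_sup_ge0.
- by rewrite lee_fin ltW.
have := uU setT _ measurableT (msup setT) (fun x _ => path_sup_ge0 x).
rewrite preimage_setT setTI => ->.
by rewrite integral_path_sup gt0_muley// lte_fin.
Qed.
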